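(* Let $f(\mathbf{x})\in\mathbb{R}[x_1,\dots,x_n]$ be a polynomial of degree $d$. If $f$ has a monic symmetric determinantal representation (or a monic Hermitian determinantal representation) of size $d$, then for every $i=1,\dots,n$ all the roots of the univariate polynomial $f_{x_i}=f(0,\dots,0,x_i,0,\dots,0)$ are real.
   Context: A monic symmetric (respectively Hermitian) determinantal representation of size $d$ of $f$ is an expression $f(\mathbf{x})=\det(I+x_1A_1+\dots+x_nA_n)$ where $I$ is the $d\times d$ identity matrix and $A_1,\dots,A_n$ are real symmetric (respectively Hermitian) $d\times d$ matrices. The polynomial $f_{x_i}$ is obtained from $f$ by setting all variables other than $x_i$ to zero; ''roots'' means complex roots. *)

(* Defs.v *)
From mathcomp Require Import all_boot all_order all_algebra.
From mathcomp Require Import reals complex mpoly.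

Set Implicit Arguments.
Unset Strict Implicit.
Unset Printing Implicit Defensive.

Import Order.TTheory GRing.Theory Num.Theory.
Local Open Scope ring_scope.

Definition monic_pencil (K : comNzRingType) (n d : nat) (A : 'I_n -> 'M[K]_d) :
    'M[{mpoly K[n]}]_d :=
  1%:M + \sum_(i < n) 'X_i *: map_mx (@mpolyC n K) (A i).

Definition has_monic_symmetric_detrep (R : realType) (n : nat)
    (f : {mpoly R[n]}) (d : nat) : Prop :=
  exists A : 'I_n -> 'M[R]_d,
    (forall i, A i \is symmetricmx) /\ f = \det (monic_pencil A).

(* The matrices are complex, so the identity holds between polynomials over
   the complex numbers: f is mapped there by the embedding of the reals. *)
Definition has_monic_hermitian_detrep (R : realType) (n : nat)
    (f : {mpoly R[n]}) (d : nat) : Prop :=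
  exists A : 'I_n -> 'M[complex R]_d,
    (forall i, A i \is hermsymmx) /\
    map_mpoly (real_complex R) f = \det (monic_pencil A).

(* f(0, ..., 0, x_i, 0, ..., 0) *)
Definition restrict_to_var (R : comNzRingType) (n : nat) (f : {mpoly R[n]})
    (i : 'I_n) : {poly R} :=
  mmap polyC (fun j => if j == i then 'X else 0) f.

(* Main.v *)
Require Import Defs.
From mathcomp Require Import all_boot all_order all_algebra.
From mathcomp Require Import reals complex mpoly.

(** A zero of a monic pencil is governed by a Rayleigh quotient.  If [z] is a
    root of [det (I + z A)] with [A] Hermitian, some non-zero row vector [v]
    satisfies [v (I + z A) = 0].  Pairing with the conjugate transpose of [v]
    gives [|v|^2 + z (v A v^* ) = 0].  Both [|v|^2] and [v A v^* ] are real, and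
    the former is non-zero, so [z = - |v|^2 / (v A v^* )] is real
    ([hermitian_pencil_root_real]).

    Setting all variables but [x_i] to zero turns the given pencil into
    [I + x_i A_i], so the univariate restriction takes the value
    [det (I + z A_i)] at [z] ([horner_restrict_detrep]).  A real symmetric
    representation is a Hermitian one after extension of scalars
    ([symmetric_detrep_hermitian]), hence one argument covers both cases. *)

Set Implicit Arguments.
Unset Strict Implicit.
Unset Printing Implicit Defensive.

Import Order.TTheory GRing.Theory Num.Theory.
Local Open Scope ring_scope.
Local Open Scope sesquilinear_scope.

Lemma rmorph_mmap (n : nat) (R S T : nzRingType) (g : {rmorphism S -> T})
    (f : R -> S) (h : 'I_n -> S) (p : {mpoly R[n]}) :
  g (mmap f h p) = mmap (g \o f) (g \o h) p.
Proof.
rewrite /mmap rmorph_sum; apply: eq_bigr => m _.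
rewrite rmorphM rmorph_prod; congr (_ * _).
by apply: eq_bigr => i _; rewrite rmorphXn.
Qed.

(** Both sides substitute the same point of the [i]-th coordinate axis: each is
    a ring morphism applied to an [mmap], so they are compared monomial by
    monomial. *)
Lemma horner_map_restrict_to_var (R S : comNzRingType)
    (phi : {rmorphism R -> S}) (n : nat) (f : {mpoly R[n]}) (i : 'I_n) (z : S) :
  (map_poly phi (restrict_to_var f i)).[z] =
    (map_mpoly phi f).@[fun j => if j == i then z else 0].
Proof.
rewrite -[LHS]/(horner_eval z _) /restrict_to_var !rmorph_mmap.
rewrite /mmap; apply: eq_bigr => m _ /=; congr (_ * _).
  by rewrite /horner_eval map_polyC hornerC mevalC.
apply: eq_bigr => j _ /=; rewrite mevalXU; congr (_ ^+ _).
by case: ifP => _; rewrite /horner_eval ?map_polyX ?hornerX // rmorph0 horner0.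
Qed.

Lemma map_monic_pencil (R S : comNzRingType) (phi : {rmorphism R -> S})
    (n d : nat) (A : 'I_n -> 'M[R]_d) :
  map_mx (map_mpoly phi) (monic_pencil A) =
    monic_pencil (fun i => map_mx phi (A i)).
Proof.
rewrite /monic_pencil map_mxD map_mx1 map_mx_sum; congr (_ + _).
apply: eq_bigr => i _; rewrite map_mxZ /= map_mpolyX; congr (_ *: _).
by apply/matrixP => j k; rewrite !mxE map_mpolyC.
Qed.

Lemma meval_monic_pencil (R : comNzRingType) (n d : nat)
    (A : 'I_n -> 'M[R]_d) (v : 'I_n -> R) :
  map_mx (meval v) (monic_pencil A) = 1%:M + \sum_(i < n) v i *: A i.
Proof.
rewrite /monic_pencil map_mxD map_mx1 map_mx_sum; congr (_ + _).
apply: eq_bigr => i _; rewrite map_mxZ /= mevalXU; congr (_ *: _).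
by apply/matrixP => j k; rewrite !mxE mevalC.
Qed.

(** With this, real symmetric pencils need no argument of their own: over the
    complex numbers a real symmetric matrix is Hermitian, and the determinant
    commutes with the extension of scalars. *)
Lemma symmetric_detrep_hermitian (R : realType) (n : nat) (f : {mpoly R[n]})
    (d : nat) :
  has_monic_symmetric_detrep f d -> has_monic_hermitian_detrep f d.
Proof.
case=> A [symA ->]; exists (fun i => map_mx (real_complex R) (A i)); split.
  move=> i; apply: realsym_hermsym.
    apply/is_hermitianmxP; rewrite expr0 scale1r map_mx_id //.
    have /is_hermitianmxP := symA i.
    by rewrite expr0 scale1r map_mx_id // map_trmx => <-.
  apply/mxOverP => j k; rewrite mxE; apply/CrealP; exact: conjc_real.
by rewrite -map_monic_pencil det_map_mx.
Qed.

(** The 1 x 1 matrix [v A v^* ] equals its own conjugate transpose, so its entry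
    is fixed by conjugation. *)
Lemma hermitian_form_real (C : numClosedFieldType) (d : nat) (A : 'M[C]_d)
    (v : 'rV[C]_d) :
  A \is hermsymmx -> (v *m A *m v^t*) 0 0 \is Num.real.
Proof.
move=> /is_hermitianmxP; rewrite expr0 scale1r => hermA.
apply/CrealP.
have -> : ((v *m A *m v^t*) 0 0)^* = ((v *m A *m v^t*)^t*) 0 0 by rewrite !mxE.
by rewrite !trmx_mul !map_mxM /= trmxCK -hermA mulmxA.
Qed.

(** For [v] in the kernel of the singular matrix [I + z A], [z] is minus the
    inverse of the Rayleigh quotient of [A] at [v]. *)
Lemma hermitian_pencil_root_real (C : numClosedFieldType) (d : nat)
    (A : 'M[C]_d) (z : C) :
  A \is hermsymmx -> \det (1%:M + z *: A) = 0 -> z \is Num.real.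
Proof.
move=> hermA /eqP/det0P[v v_neq0 ker_v].
set q := (v *m A *m v^t*) 0 0.
have q_real : q \is Num.real by apply: hermitian_form_real.
have norm_gt0 : 0 < dotmx v v by apply: dotmx_is_dotmx.
have rayleigh : dotmx v v + z * q = 0.
  have := congr1 (fun w => (w *m v^t*) 0 0) ker_v.
  rewrite mulmxDr mulmx1 -scalemxAr mulmxDl mul0mx -scalemxAl.
  by rewrite mxE [X in _ + X]mxE [RHS]mxE -dotmxE.
have q_neq0 : q != 0.
  apply: contraTneq norm_gt0 => q0; move: rayleigh.
  by rewrite q0 mulr0 addr0 => ->; rewrite ltxx.
have -> : z = - dotmx v v / q.
  by rewrite (addr0_eq rayleigh) mulfK.
by apply: realM; rewrite ?realV // realN gtr0_real.
Qed.

Lemma horner_restrict_detrep (R : realType) (n d : nat) (f : {mpoly R[n]})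
    (A : 'I_n -> 'M[complex R]_d) (i : 'I_n) (z : complex R) :
  map_mpoly (real_complex R) f = \det (monic_pencil A) ->
  (map_poly (real_complex R) (restrict_to_var f i)).[z] =
    \det (1%:M + z *: A i).
Proof.
move=> detrep; rewrite horner_map_restrict_to_var detrep -det_map_mx.
rewrite meval_monic_pencil (bigD1 i) //= eqxx big1 ?addr0 // => j /negPf ->.
by rewrite scale0r.
Qed.

(* msize f = d.+1 says that f has degree d. *)
Theorem lemma3p1 (R : realType) (n d : nat) (f : {mpoly R[n]})
    (deg_f : msize f = d.+1)
    (detrep_f : has_monic_symmetric_detrep f d \/
                has_monic_hermitian_detrep f d) :
  forall (i : 'I_n) (z : complex R),
    root (map_poly (real_complex R) (restrict_to_var f i)) z ->
    z \is Num.real.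
Proof.
move=> i z; have [A [hermA detrepA]] : has_monic_hermitian_detrep f d.
  by case: detrep_f => // /symmetric_detrep_hermitian.
rewrite rootE (horner_restrict_detrep i z detrepA) => /eqP.
exact: hermitian_pencil_root_real.
Qed.
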